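(* Let $A$ be a residuated lattice. Then the following are equivalent: (1) $A$ is a semilocal MV-algebra (respectively, a semilocal BL-algebra); (2) $A$ is isomorphic to a finite direct product of local MV-algebras (respectively, of local BL-algebras).
   Context: A residuated lattice is a commutative integral bounded one: a structure $(A,\vee ,\wedge ,\odot ,\rightarrow ,0,1)$ such that $(A,\vee ,\wedge ,0,1)$ is a bounded lattice, $(A,\odot ,1)$ is a commutative monoid, and $a\leq b\rightarrow c$ iff $a\odot b\leq c$ for all $a,b,c\in A$. Write $\neg a=a\rightarrow 0$. A BL-algebra is a residuated lattice satisfying $a\wedge b=a\odot (a\rightarrow b)$ and $(a\rightarrow b)\vee (b\rightarrow a)=1$ for all $a,b$; an MV-algebra (viewed as a residuated lattice) is a BL-algebra satisfying $\neg\neg a=a$ for all $a$. A filter of $A$ is a nonempty subset closed under $\odot$ and upward closed. A maximal filter is a maximal element, under inclusion, of the set of filters different from $A$. $A$ is local iff it has exactly one maximal filter, and semilocal iff it has only finitely many maximal filters. *)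

(* Defs.v *)
From HB Require Import structures.
From mathcomp Require Import all_boot all_order.
From mathcomp Require Import boolp classical_sets functions cardinality.

Set Implicit Arguments.
Unset Strict Implicit.
Unset Printing Implicit Defensive.

Import Order.TTheory.

Declare Scope residuated_scope.
Delimit Scope residuated_scope with RL.
Local Open Scope order_scope.

Reserved Notation "a ⊙ b" (at level 40, left associativity).
Reserved Notation "a ⇒ b" (at level 55, right associativity).
Reserved Notation "¬ a" (at level 35, right associativity).

(* Commutative, integral and bounded: the unit of the monoid is the top of the
   lattice. The lattice may be trivial, i.e. \bot = \top is allowed. *)
HB.mixin Record TBLattice_isResiduated d T of Order.TBLattice d T := {
  odot : T -> T -> T;
  rimp : T -> T -> T;
  odotA : associative odot;
  odotC : commutative odot;
  odot1x : left_id \top odot;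
  le_rimp : forall a b c : T, (a <= rimp b c) = (odot a b <= c)
}.

#[short(type="residuatedLatticeType")]
HB.structure Definition ResiduatedLattice d :=
  { T of TBLattice_isResiduated d T & Order.TBLattice d T }.

Notation "a ⊙ b" := (odot a b) : residuated_scope.
Notation "a ⇒ b" := (rimp a b) : residuated_scope.
Local Open Scope residuated_scope.

Definition rneg d (A : residuatedLatticeType d) (a : A) : A := a ⇒ \bot.
Notation "¬ a" := (rneg a) : residuated_scope.

Definition BL_algebra d (A : residuatedLatticeType d) : Prop :=
  (forall a b : A, a `&` b = a ⊙ (a ⇒ b)) /\
  (forall a b : A, (a ⇒ b) `|` (b ⇒ a) = \top).

Definition MV_algebra d (A : residuatedLatticeType d) : Prop :=
  BL_algebra A /\ (forall a : A, ¬ ¬ a = a).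

Definition is_filter d (A : residuatedLatticeType d) (F : set A) : Prop :=
  [/\ (F !=set0)%classic,
      (forall a b : A, F a -> F b -> F (a ⊙ b)) &
      (forall a b : A, F a -> a <= b -> F b)].

Definition proper_filter d (A : residuatedLatticeType d) (F : set A) : Prop :=
  is_filter F /\ F <> [set: A]%classic.

Definition maximal_filter d (A : residuatedLatticeType d) (F : set A) : Prop :=
  proper_filter F /\
  (forall G : set A, proper_filter G -> (F `<=` G)%classic -> G = F).

Definition local d (A : residuatedLatticeType d) : Prop :=
  exists! F : set A, maximal_filter F.

Definition semilocal d (A : residuatedLatticeType d) : Prop :=
  finite_set [set F : set A | maximal_filter F]%classic.

Definition rl_isomorphic d d' (A : residuatedLatticeType d)
    (B : residuatedLatticeType d') : Prop :=
  exists f : A -> B,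
    [/\ bijective f,
        {morph f : a b / a `|` b} /\ {morph f : a b / a `&` b},
        {morph f : a b / a ⊙ b} /\ {morph f : a b / a ⇒ b} &
        f \bot = \bot /\ f \top = \top].

(* Direct product of a finite family, with componentwise order and operations;
   for n = 0 it is the trivial residuated lattice. *)
Definition rl_prod d n (B : 'I_n -> residuatedLatticeType d) : Type :=
  {dffun forall i : 'I_n, B i}.

Section DirectProduct.
Context d n (B : 'I_n -> residuatedLatticeType d).
Implicit Types f g h : rl_prod B.

HB.instance Definition _ := Choice.copy (rl_prod B) {dffun forall i, B i}.

Definition prod_le f g : bool := [forall i, f i <= g i].
Definition prod_meet f g : rl_prod B := [ffun i => f i `&` g i].
Definition prod_join f g : rl_prod B := [ffun i => f i `|` g i].
Definition prod_bot : rl_prod B := [ffun i => \bot].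
Definition prod_top : rl_prod B := [ffun i => \top].
Definition prod_odot f g : rl_prod B := [ffun i => f i ⊙ g i].
Definition prod_rimp f g : rl_prod B := [ffun i => f i ⇒ g i].

Lemma prod_le_refl : reflexive prod_le.
Proof. by move=> f; apply/forallP. Qed.

Lemma prod_le_anti : antisymmetric prod_le.
Proof.
move=> f g /andP[/forallP fg /forallP gf]; apply/ffunP => i.
by apply/le_anti; rewrite fg gf.
Qed.

Lemma prod_le_trans : transitive prod_le.
Proof.
move=> g f h /forallP fg /forallP gh; apply/forallP => i.
exact: le_trans (fg i) (gh i).
Qed.

HB.instance Definition _ := Order.Le_isPOrder.Build d (rl_prod B)
  prod_le_refl prod_le_anti prod_le_trans.

Lemma prod_leP f g : reflect (forall i, f i <= g i) (f <= g).
Proof. exact: forallP. Qed.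

Lemma prod_lexI f g h : (f <= prod_meet g h) = (f <= g) && (f <= h).
Proof.
apply/prod_leP/andP => [fgh|[/prod_leP fg /prod_leP fh] i]; last first.
  by rewrite ffunE lexI fg fh.
by split; apply/prod_leP => i; have := fgh i; rewrite ffunE lexI => /andP[].
Qed.

Lemma prod_leUx f g h : (prod_join f g <= h) = (f <= h) && (g <= h).
Proof.
apply/prod_leP/andP => [fgh|[/prod_leP fh /prod_leP gh] i]; last first.
  by rewrite ffunE leUx fh gh.
by split; apply/prod_leP => i; have := fgh i; rewrite ffunE leUx => /andP[].
Qed.

HB.instance Definition _ := Order.POrder_isMeetSemilattice.Build d (rl_prod B)
  prod_lexI.
HB.instance Definition _ := Order.POrder_isJoinSemilattice.Build d (rl_prod B)
  prod_leUx.

Lemma prod_le0x f : prod_bot <= f.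
Proof. by apply/prod_leP => i; rewrite ffunE le0x. Qed.

Lemma prod_lex1 f : f <= prod_top.
Proof. by apply/prod_leP => i; rewrite ffunE lex1. Qed.

HB.instance Definition _ := Order.hasBottom.Build d (rl_prod B) prod_le0x.
HB.instance Definition _ := Order.hasTop.Build d (rl_prod B) prod_lex1.

Lemma prod_odotA : associative prod_odot.
Proof. by move=> f g h; apply/ffunP => i; rewrite !ffunE odotA. Qed.

Lemma prod_odotC : commutative prod_odot.
Proof. by move=> f g; apply/ffunP => i; rewrite !ffunE odotC. Qed.

Lemma prod_odot1x : left_id \top prod_odot.
Proof. by move=> f; apply/ffunP => i; rewrite !ffunE odot1x. Qed.

Lemma prod_le_rimp f g h : (f <= prod_rimp g h) = (prod_odot f g <= h).
Proof.
by apply/prod_leP/prod_leP => le_fgh i; have := le_fgh i;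
  rewrite !ffunE le_rimp.
Qed.

HB.instance Definition _ := TBLattice_isResiduated.Build d (rl_prod B)
  prod_odotA prod_odotC prod_odot1x prod_le_rimp.

End DirectProduct.

(* Main.v *)
Require Import Defs.
From HB Require Import structures.
From mathcomp Require Import all_boot all_order.
From mathcomp Require Import boolp classical_sets functions cardinality.

Set Implicit Arguments.
Unset Strict Implicit.
Unset Printing Implicit Defensive.

Import Order.TTheory.

(** Only prelinearity, [(a ⇒ b) `|` (b ⇒ a) = \top], is needed to decompose a
    semilocal residuated lattice [A]; the BL and MV identities then pass to the
    factors, which are homomorphic images of [A], and come back from them, since
    the projections separate points.

    Decomposition. Let [M_1, ..., M_n] be the maximal filters. By Zorn's lemma an
    element in no maximal filter is nilpotent ([nilpotent_of_maximal]). Fix [i].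
    Multiplying elements of [M_i] outside each other [M_j], and raising the
    product to a power, gives [b] in [M_i] with [¬ b] in every other [M_j]
    ([maximal_filter_neg]). Then [y = ¬ b ⇒ b] is in [M_i] only, [x = b ⇒ ¬ b] is
    in all the [M_j] except [M_i], and [x `|` y = \top]. The product of [x] and
    [y] is in no maximal filter, so some powers of [x] and [y] have product
    bottom, while their join is still top: they are complementary
    ([maximal_filter_separation]). This gives a complemented [e_i] which lies in
    [M_i] and in no other maximal filter. The products [e_i ⊙ e_j], as well as
    the product of all the complements, are idempotent and in no maximal filter,
    hence bottom: the [e_i] are orthogonal with join top, and
    [a |-> (a `&` e_i)_i] is an isomorphism from [A] to the product of the
    intervals [[\bot, e_i]] ([orthogonal_product]). In such an interval the
    elements outside [M_i] are nilpotent, so it is local ([li_local]).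

    Converse. Let [A] embed in a finite product of local [B_i], and let [M] be a
    maximal filter of [A]. If each coordinate of some element of [M] left the
    maximal filter of [B_i], a product of such elements would lie in [M] and have
    all its coordinates nilpotent, hence be nilpotent. So [M] is the preimage of
    the maximal filter of one of the [B_i], and there are finitely many of those
    ([semilocal_subdirect]). *)

(** * Arithmetic of residuated lattices *)

HB.instance Definition _ d (A : residuatedLatticeType d) :=
  Monoid.isComLaw.Build A Order.top (@odot d A)
    (@odotA d A) (@odotC d A) (@odot1x d A).

Section Arithmetic.
Local Open Scope order_scope.
Local Open Scope residuated_scope.
Context d (A : residuatedLatticeType d).
Implicit Types a b c e x y : A.

Lemma odotx1 a : a ⊙ \top = a.
Proof. by rewrite odotC odot1x. Qed.

Lemma odotACA a b c e : (a ⊙ b) ⊙ (c ⊙ e) = (a ⊙ c) ⊙ (b ⊙ e).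
Proof. exact: Monoid.mulmACA. Qed.

Lemma le_odot2r b a c : a <= c -> a ⊙ b <= c ⊙ b.
Proof. by move=> ac; rewrite -le_rimp (le_trans ac)// le_rimp. Qed.

Lemma le_odot2 a b c e : a <= b -> c <= e -> a ⊙ c <= b ⊙ e.
Proof.
by move=> ab ce; rewrite (le_trans (le_odot2r c ab))// ![b ⊙ _]odotC le_odot2r.
Qed.

Lemma le_odotl a b : a ⊙ b <= a.
Proof. by rewrite -[leRHS]odotx1 le_odot2// lex1. Qed.

Lemma le_odotr a b : a ⊙ b <= b.
Proof. by rewrite odotC le_odotl. Qed.

Lemma odot0x a : \bot ⊙ a = \bot.
Proof. by apply/le_anti; rewrite le_odotl le0x. Qed.

Lemma rimp_mp a b : a ⊙ (a ⇒ b) <= b.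
Proof. by rewrite odotC -le_rimp. Qed.

Lemma odotUl a b c : (a `|` b) ⊙ c = a ⊙ c `|` b ⊙ c.
Proof.
apply/le_anti/andP; split; last by rewrite leUx !le_odot2r ?leUl ?leUr.
by rewrite -le_rimp leUx !le_rimp leUl leUr.
Qed.

Lemma odotUr a b c : c ⊙ (a `|` b) = c ⊙ a `|` c ⊙ b.
Proof. by rewrite ![c ⊙ _]odotC odotUl. Qed.

Lemma joins_odotl n (F : 'I_n -> A) a :
  (\join_(i < n) F i) ⊙ a = \join_(i < n) (F i ⊙ a).
Proof.
by apply: (big_morph (odot^~ a)) => [x y|]; [exact: odotUl | exact: odot0x].
Qed.

Lemma join_odot_top x a b :
  x `|` a = \top -> x `|` b = \top -> x `|` a ⊙ b = \top.
Proof.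
move=> xa xb; apply/eqP; rewrite -le1x -[leLHS]odotx1 -{1}xa -xb.
rewrite odotUr !odotUl !leUx leUr (le_trans (le_odotl x x) (leUl _ _)).
by rewrite (le_trans (le_odotr a x) (leUl _ _))
           (le_trans (le_odotl x b) (leUl _ _)).
Qed.

Lemma join_bigodot_top n (F : 'I_n -> A) x :
  (forall i, x `|` F i = \top) -> x `|` \big[@odot d A / \top]_(i < n) F i = \top.
Proof.
move=> xF; apply: (big_ind (fun a => x `|` a = \top)) => // [|a b].
  by rewrite joinx1.
exact: join_odot_top.
Qed.

(** The [k]-th power of [a] for the monoid operation. *)
Definition rpow a k : A := iter k (odot a) \top.

Lemma rpowD a k l : rpow a (k + l) = rpow a k ⊙ rpow a l.
Proof.
by elim: k => [|k IHk]; rewrite ?odot1x// addSn /= -odotA -IHk.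
Qed.

Lemma rpowMn a b k : rpow (a ⊙ b) k = rpow a k ⊙ rpow b k.
Proof.
elim: k => [|k /= ->]; first by rewrite odot1x.
exact: odotACA.
Qed.

Lemma le_rpow a b k : a <= b -> rpow a k <= rpow b k.
Proof. by move=> ab; elim: k => //= k IHk; rewrite le_odot2. Qed.

Lemma le_rpow_exp a k l : (k <= l)%N -> rpow a l <= rpow a k.
Proof. by move=> /subnKC <-; rewrite rpowD le_odotl. Qed.

Lemma join_rpow_top x y k :
  x `|` y = \top -> rpow x k `|` rpow y k = \top.
Proof.
have half u v : u `|` v = \top -> u `|` rpow v k = \top.
  move=> uv; elim: k => [|k IHk]; first by rewrite joinx1.
  exact: join_odot_top.
by move=> /half; rewrite joinC => /half; rewrite joinC.
Qed.

(** Some power of [a] is bottom. *)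
Definition nilpotent a := exists k, rpow a k = \bot.

Lemma le_nilpotent a b : a <= b -> nilpotent b -> nilpotent a.
Proof.
move=> ab [k bk]; exists k; apply/eqP.
by rewrite -lex0 -bk le_rpow.
Qed.

Lemma nilpotent_idem a : nilpotent a -> a ⊙ a = a -> a = \bot.
Proof.
move=> [k ak] aa; apply/eqP; rewrite -lex0 -ak {ak}.
by elim: k => [|k IHk /=]; rewrite ?lex1// -{1}aa le_odot2.
Qed.

(** Elements of the Boolean center: those with a lattice complement. *)
Definition complemented e := exists c, e `|` c = \top /\ e ⊙ c = \bot.

Lemma complement_idem e c : e `|` c = \top -> e ⊙ c = \bot -> e ⊙ e = e.
Proof. by move=> ec e0; rewrite -[RHS]odotx1 -ec odotUr e0 joinx0. Qed.

(** Multiplying by a complemented element is meeting with it. *)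
Lemma complemented_meet e x : complemented e -> x `&` e = x ⊙ e.
Proof.
move=> [c [ec e0]]; apply/le_anti/andP; split; last first.
  by rewrite lexI le_odotl le_odotr.
rewrite -[leLHS]odotx1 -ec odotUr leUx le_odot2 ?leIl//=.
by rewrite (le_trans (le_odot2 (leIr _ _) (lexx c)))// e0 le0x.
Qed.

Lemma complemented_odot_id e x : complemented e -> x <= e -> x ⊙ e = x.
Proof. by move=> /complemented_meet <- /meet_idPl. Qed.

End Arithmetic.

(** * Maximal filters *)

Section Filters.
Local Open Scope order_scope.
Local Open Scope classical_set_scope.
Local Open Scope residuated_scope.
Context d (A : residuatedLatticeType d).
Implicit Types (a b x y : A) (F G M : set A).

Lemma filter_top F : is_filter F -> F \top.
Proof. by case=> -[a Fa] _ up; apply: up Fa (lex1 a). Qed.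

Lemma filter_rpow F a k : is_filter F -> F a -> F (rpow a k).
Proof.
move=> fF Fa; elim: k => [|k IHk]; first exact: filter_top.
by case: fF => _ FM _; apply: FM.
Qed.

Lemma filter_bigodot F n (a : 'I_n -> A) (P : pred 'I_n) : is_filter F ->
  (forall i, P i -> F (a i)) -> F (\big[@odot d A / \top]_(i < n | P i) a i).
Proof.
move=> fF Fa; apply: big_ind => //; first exact: filter_top.
by case: fF.
Qed.

Lemma le_bigodot n (a : 'I_n -> A) (P : pred 'I_n) i : P i ->
  \big[@odot d A / \top]_(j < n | P j) a j <= a i.
Proof. by move=> Pi; rewrite (bigD1 i)//= le_odotl. Qed.

Lemma proper_filterP F : proper_filter F <-> is_filter F /\ ~ F \bot.
Proof.
split=> -[fF pF]; split=> //; last by move=> FT; apply: pF; rewrite FT.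
move=> F0; apply: pF; apply/seteqP; split=> // a _.
by case: fF => _ _ up; apply: up F0 (le0x a).
Qed.

Lemma proper_filter_nilpotent F a : proper_filter F -> F a -> ~ nilpotent a.
Proof.
by move=> /proper_filterP[fF F0] Fa [k ak]; apply: F0; rewrite -ak; apply: filter_rpow.
Qed.

(** An element outside a maximal filter [M] has a power whose negation lies in
    [M], because adding it to [M] generates the improper filter. *)
Lemma maximal_filter_neg M a : maximal_filter M -> ~ M a ->
  exists k, M (¬ (rpow a k)).
Proof.
move=> [/proper_filterP[fM M0] maxM] nMa; apply: contrapT => noneg.
have [_ MM Mup] := fM.
pose G : set A := [set z | exists m k, M m /\ m ⊙ rpow a k <= z].
have Ga : G a.
  by exists \top, 1; split; [exact: filter_top | rewrite odot1x /= odotx1].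
suff GM : G = M by apply: nMa; rewrite -GM.
apply: maxM; last by move=> m Mm; exists m, 0; rewrite odotx1.
apply/proper_filterP; split; last first.
  move=> [m [k [Mm mk]]]; apply: noneg; exists k.
  by apply: Mup Mm _; rewrite le_rimp.
split; first by exists a.
  move=> x y [m [k [Mm mk]]] [p [l [Mp pl]]]; exists (m ⊙ p), (k + l)%N.
  by rewrite rpowD odotACA le_odot2//; split=> //; apply: MM.
by move=> x y [m [k [Mm mk]]] xy; exists m, k; split=> //; apply: le_trans xy.
Qed.

(** The intersection of the complements of the maximal filters consists of
    nilpotent elements; this is where Zorn's lemma is used. *)
Lemma nilpotent_of_maximal a :
  (forall M, maximal_filter M -> ~ M a) -> nilpotent a.
Proof.
move=> notM; apply: contrapT => nnil.
(* The empty set is admitted, so that the union of the empty chain belongs to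
   the family. *)
pose P : set (set A) := [set F | [/\ F !=set0 -> F a, ~ F \bot,
  (forall x y, F x -> F y -> F (x ⊙ y)) & (forall x y, F x -> x <= y -> F y)]].
have [C CP totC|F [[Fa F0 FM Fup] maxF]] := @Zorn_bigcup A P.
  split.
  - move=> [x [F CF Fx]]; exists F => //.
    by case: (CP F CF) => + _ _ _; apply; exists x.
  - by move=> [F CF F0]; case: (CP F CF).
  - move=> x y [F CF Fx] [G CG Gy].
    have [FG|GF] := totC _ _ CF CG.
      by exists G => //; case: (CP G CG) => _ _ + _; apply=> //; apply: FG.
    by exists F => //; case: (CP F CF) => _ _ + _; apply=> //; apply: GF.
  - move=> x y [F CF Fx] xy; exists F => //.
    by case: (CP F CF) => _ _ _ Fup; apply: Fup Fx xy.
have F_a : F a.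
  apply: contrapT => nFa.
  apply: (maxF [set z | exists k, rpow a k <= z]).
    split; last by move=> /(_ a) sub; apply/nFa/sub; exists 1; rewrite /= odotx1.
    by move=> x Fx; case: nFa; apply: Fa; exists x.
  split.
  - by move=> _; exists 1; rewrite /= odotx1.
  - by move=> [k]; rewrite lex0 => /eqP ak; apply: nnil; exists k.
  - by move=> x y [k kx] [l ly]; exists (k + l)%N; rewrite rpowD le_odot2.
  - by move=> x y [k kx] xy; exists k; apply: le_trans xy.
have fF : is_filter F by split=> //; exists a.
apply: (notM F) => //; split; first exact/proper_filterP.
move=> G /proper_filterP[[G0 GM Gup] Gbot] FG; apply: contrapT => GF.
apply: (maxF G).
  by split=> // GsubF; apply: GF; apply/seteqP.
by split=> // _; apply: FG.
Qed.

(** A proper filter containing every non-nilpotent element is the greatest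
    proper filter, hence the only maximal one. *)
Lemma local_of_nilpotent M :
  proper_filter M -> (forall a, ~ M a -> nilpotent a) -> local A.
Proof.
move=> pM nilM.
have great F : proper_filter F -> F `<=` M.
  by move=> pF a Fa; apply: contrapT => /nilM /(proper_filter_nilpotent pF Fa).
exists M; split.
  by split=> // G /great GM MG; apply/seteqP.
by move=> F [pF maxF]; apply: maxF => //; apply: great.
Qed.

End Filters.

(** * Homomorphisms *)

Section Homomorphisms.
Local Open Scope order_scope.
Local Open Scope residuated_scope.

(** Homomorphisms of residuated lattices. *)
Definition rl_hom (d d' : Order.disp_t) (A : residuatedLatticeType d)
    (B : residuatedLatticeType d') (f : A -> B) : Prop :=
  [/\ {morph f : a b / a `|` b} /\ {morph f : a b / a `&` b},
      {morph f : a b / a ⊙ b} /\ {morph f : a b / a ⇒ b} &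
      f \bot = \bot /\ f \top = \top].

Section Image.
Context (d d' : Order.disp_t) (A : residuatedLatticeType d).
Context (B : residuatedLatticeType d').
Context (f : A -> B) (hf : rl_hom f) (surj : forall b, exists a, f a = b).

Lemma BL_algebra_image : BL_algebra A -> BL_algebra B.
Proof.
have [[fU fI] [fM fR] [f0 f1]] := hf.
by move=> [A1 A2]; split=> b c; have [a <-] := surj b; have [a' <-] := surj c;
  rewrite -!fR -?fM -?fU -?fI ?A1 ?A2.
Qed.

Lemma MV_algebra_image : MV_algebra A -> MV_algebra B.
Proof.
have [_ [_ fR] [f0 _]] := hf.
move=> [BLA A1]; split; first exact: BL_algebra_image.
by move=> b; have [a <-] := surj b; rewrite /rneg -f0 -!fR [X in f X]A1.
Qed.

End Image.

Section Subdirect.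
Context (d d' : Order.disp_t) (I : Type) (A : residuatedLatticeType d).
Context (B : I -> residuatedLatticeType d').
Context (f : forall i, A -> B i) (hf : forall i, rl_hom (@f i)).
Context (inj : forall a b, (forall i, f i a = f i b) -> a = b).

Lemma BL_algebra_subdirect : (forall i, BL_algebra (B i)) -> BL_algebra A.
Proof.
move=> BLB; split=> a b; apply: inj => i;
  have [[fU fI] [fM fR] [f0 f1]] := hf i; have [B1 B2] := BLB i.
  by rewrite fI fM fR B1.
by rewrite fU !fR B2 f1.
Qed.

Lemma MV_algebra_subdirect : (forall i, MV_algebra (B i)) -> MV_algebra A.
Proof.
move=> MVB; split; first by apply: BL_algebra_subdirect => i; case: (MVB i).
move=> a; apply: inj => i; have [_ [_ fR] [f0 _]] := hf i.
by have [_ negK] := MVB i; rewrite /rneg !fR f0; apply: negK.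
Qed.

End Subdirect.

(** If finitely many homomorphisms into local residuated lattices separate the
    points of [A], every maximal filter of [A] is the preimage of the maximal
    filter of one of the targets. *)
Lemma semilocal_subdirect (d d' : Order.disp_t) n (A : residuatedLatticeType d)
    (B : 'I_n -> residuatedLatticeType d') (f : forall i, A -> B i) :
  (forall i, rl_hom (f i)) ->
  (forall a b, (forall i, f i a = f i b) -> a = b) ->
  (forall i, local (B i)) -> semilocal A.
Proof.
move=> hf inj locB.
pose N i : set (B i) := sval (cid (locB i)).
have [maxN uniqN] : (forall i, maximal_filter (N i)) /\
    (forall i M, maximal_filter M -> N i = M).
  by split=> i; have [] := svalP (cid (locB i)).
have le_f i a b : a <= b -> f i a <= f i b.
  by have [[fU _] _ _] := hf i; rewrite !leEjoin -fU => /eqP ->.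
have f_rpow i a k : f i (rpow a k) = rpow (f i a) k.
  have [_ [fM _] [_ f1]] := hf i.
  by elim: k => //= k <-; rewrite fM.
pose preN : set (set A) :=
  [set (f i @^-1` N i)%classic | i in [set: 'I_n]]%classic.
apply: (@sub_finite_set _ _ preN); last exact: finite_image.
move=> M [pM maxM]; apply: contrapT => notN.
have fM : is_filter M by case: pM.
have wit i : exists a, M a /\ ~ N i (f i a).
  apply: contrapT => noa; apply: notN; exists i => //; apply: maxM.
    have [/proper_filterP[[_ NM Nup] N0] _] := maxN i.
    have [_ [fiM _] [f0 f1]] := hf i.
    apply/proper_filterP; split; last by rewrite /preimage/= f0.
    split.
    - by exists \top; rewrite /preimage/= f1; apply: filter_top;
        case: (maxN i) => -[].
    - by move=> a b Na Nb; rewrite /preimage/= fiM; apply: NM.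
    - by move=> a b Na /(le_f i) ab; apply: Nup Na ab.
  by move=> a Ma; apply: contrapT => Na; apply: noa; exists a.
pose a i := sval (cid (wit i)).
have [Ma Na] : (forall i, M (a i)) /\ (forall i, ~ N i (f i (a i))).
  by split=> i; have [] := svalP (cid (wit i)).
(* an element of M all of whose coordinates are nilpotent *)
pose g := \big[@odot d A / \top]_(i < n) a i.
have nilg i : nilpotent (f i g).
  apply: (@le_nilpotent _ _ _ (f i (a i))); first exact/le_f/le_bigodot.
  by apply: nilpotent_of_maximal => M' /uniqN <-.
pose k i := sval (cid (nilg i)).
apply: (@proper_filter_nilpotent _ _ M g) => //; first exact: filter_bigodot.
exists (\max_(i < n) k i)%N; apply: inj => i.
have [_ _ [f0 _]] := hf i.
apply/eqP; rewrite f0 f_rpow -lex0.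
by rewrite (le_trans (le_rpow_exp _ (leq_bigmax i)))// /k (svalP (cid (nilg i))).
Qed.

End Homomorphisms.

(** * The interval below a complemented element *)

Section LowerInterval.
Local Open Scope order_scope.
Local Open Scope residuated_scope.
Context d (A : residuatedLatticeType d) (e : A) (he : complemented e).

(** The interval from bottom to [e], with the lattice structure and the product
    of [A]; its top is [e] and its residual is that of [A] cut down to [e]. It
    depends on [he] because [e] is a unit for the product on the interval only
    when it is, for instance, complemented. *)
Definition lower_interval of complemented e : Type := {x : A | x <= e}.

Local Notation I := (lower_interval he).
Implicit Types x y z : I.

HB.instance Definition _ := Choice.copy I {x : A | x <= e}.

Definition li_val x : A := sval x.

Lemma li_valP x : li_val x <= e. Proof. exact: svalP x. Qed.

Lemma li_val_inj : injective li_val. Proof. exact: val_inj. Qed.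

(** The retraction of [A] onto the interval. It is defined by a meet, which
    fixes the interval pointwise for any [e], and agrees with the product by [e]
    because [e] is complemented. *)
Definition li_proj (a : A) : I := exist _ (a `&` e) (leIr e a).

Lemma li_val_proj a : li_val (li_proj a) = a ⊙ e.
Proof. exact: complemented_meet. Qed.

Lemma li_valK : cancel li_val li_proj.
Proof. by move=> x; apply/li_val_inj/meet_idPl/li_valP. Qed.

Lemma li_val_le_proj x a : (li_val x <= li_val (li_proj a)) = (li_val x <= a).
Proof. by rewrite lexI li_valP andbT. Qed.

Definition li_le x y := li_val x <= li_val y.

Lemma li_le_refl : reflexive li_le. Proof. by move=> x; apply: lexx. Qed.

Lemma li_le_anti : antisymmetric li_le.
Proof. by move=> x y /le_anti /li_val_inj. Qed.

Lemma li_le_trans : transitive li_le.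
Proof. by move=> y x z; apply: le_trans. Qed.

HB.instance Definition _ := Order.Le_isPOrder.Build d I
  li_le_refl li_le_anti li_le_trans.

Lemma li_leE x y : (x <= y) = (li_val x <= li_val y). Proof. by []. Qed.

Definition li_meet x y := li_proj (li_val x `&` li_val y).
Definition li_join x y := li_proj (li_val x `|` li_val y).
Definition li_bot := li_proj \bot.
Definition li_top := li_proj \top.
Definition li_odot x y := li_proj (li_val x ⊙ li_val y).
Definition li_rimp x y := li_proj (li_val x ⇒ li_val y).

Lemma li_val_meet x y : li_val (li_meet x y) = li_val x `&` li_val y.
Proof. by apply/meet_idPl; rewrite leIxl// li_valP. Qed.

Lemma li_val_join x y : li_val (li_join x y) = li_val x `|` li_val y.
Proof. by apply/meet_idPl; rewrite leUx !li_valP. Qed.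

Lemma li_val_odot x y : li_val (li_odot x y) = li_val x ⊙ li_val y.
Proof. by apply/meet_idPl; rewrite (le_trans (le_odotl _ _))// li_valP. Qed.

Lemma li_val_bot : li_val li_bot = \bot. Proof. exact: meet0x. Qed.

Lemma li_val_top : li_val li_top = e. Proof. exact: meet1x. Qed.

Lemma li_lexI x y z : (x <= li_meet y z) = (x <= y) && (x <= z).
Proof. by rewrite !li_leE li_val_meet lexI. Qed.

Lemma li_leUx x y z : (li_join x y <= z) = (x <= z) && (y <= z).
Proof. by rewrite !li_leE li_val_join leUx. Qed.

HB.instance Definition _ := Order.POrder_isMeetSemilattice.Build d I li_lexI.
HB.instance Definition _ := Order.POrder_isJoinSemilattice.Build d I li_leUx.

Lemma li_le0x x : li_bot <= x. Proof. by rewrite li_leE li_val_bot le0x. Qed.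

Lemma li_lex1 x : x <= li_top. Proof. by rewrite li_leE li_val_top li_valP. Qed.

HB.instance Definition _ := Order.hasBottom.Build d I li_le0x.
HB.instance Definition _ := Order.hasTop.Build d I li_lex1.

Lemma li_odotA : associative li_odot.
Proof. by move=> x y z; apply: li_val_inj; rewrite !li_val_odot odotA. Qed.

Lemma li_odotC : commutative li_odot.
Proof. by move=> x y; apply: li_val_inj; rewrite !li_val_odot odotC. Qed.

Lemma li_odot1x : left_id \top li_odot.
Proof.
move=> x; apply: li_val_inj; rewrite li_val_odot li_val_top odotC.
exact/complemented_odot_id/li_valP.
Qed.

Lemma li_le_rimp x y z : (x <= li_rimp y z) = (li_odot x y <= z).
Proof. by rewrite !li_leE li_val_le_proj li_val_odot le_rimp. Qed.

HB.instance Definition _ := TBLattice_isResiduated.Build d I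
  li_odotA li_odotC li_odot1x li_le_rimp.

Lemma li_val0 : li_val (\bot : I) = \bot. Proof. exact: li_val_bot. Qed.

Lemma li_val1 : li_val (\top : I) = e. Proof. exact: li_val_top. Qed.

Lemma li_proj_hom : rl_hom li_proj.
Proof.
have [c [ec e0]] := he; have ee := complement_idem ec e0.
split; [split=> a b | split=> a b | split].
- by apply: li_val_inj; rewrite li_val_join !li_val_proj odotUl.
- by apply: li_val_inj; rewrite li_val_meet /li_val /= meetACA meetxx.
- apply: li_val_inj; rewrite li_val_odot !li_val_proj.
  by rewrite odotACA ee.
- apply/le_anti/andP; split; rewrite li_leE.
    rewrite li_val_le_proj li_val_proj le_rimp !li_val_proj.
    by rewrite odotACA ee le_odot2r// odotC rimp_mp.
  rewrite li_val_le_proj !li_val_proj le_rimp -odotA [e ⊙ a]odotC odotC.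
  by rewrite (le_trans (rimp_mp _ _))// le_odotl.
- exact: li_val_inj.
- exact: li_val_inj.
Qed.

Lemma li_val_rpow x k : li_val (rpow x k) = rpow (li_val x) k ⊙ e.
Proof.
elim: k => [|k IHk]; first by rewrite odot1x li_val1.
by rewrite [LHS]li_val_odot IHk odotA.
Qed.

Lemma li_nilpotent x : nilpotent (li_val x) -> nilpotent x.
Proof.
move=> [k xk]; exists k; apply: li_val_inj.
by rewrite li_val_rpow xk odot0x li_val0.
Qed.

(** The interval below [e] is local when [e] lies in exactly one maximal
    filter: an element below [e] outside that filter is in no maximal filter
    at all, hence nilpotent. *)
Lemma li_local (M : set A) : maximal_filter M -> M e ->
  (forall N : set A, maximal_filter N -> N e -> N = M) -> local I.
Proof.
move=> maxM Me uniqM.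
have [/proper_filterP[[_ MM Mup] M0] _] := maxM.
pose F : set I := fun x => M (li_val x).
apply: (@local_of_nilpotent _ _ F) => [|x Fx].
  apply/proper_filterP; split; last by rewrite /F li_val0.
  split; first by exists \top; rewrite /F li_val1.
    by move=> x y Mx My; rewrite /F li_val_odot; apply: MM.
  by move=> x y Mx xy; apply: Mup Mx xy.
apply/li_nilpotent/nilpotent_of_maximal => N maxN Nx.
have [/proper_filterP[[_ _ Nup] _] _] := maxN.
by apply: Fx; rewrite /F -(uniqM N)//; apply: Nup Nx (li_valP x).
Qed.

End LowerInterval.

(** * Orthogonal families of complemented elements *)

Section Decomposition.
Local Open Scope order_scope.
Local Open Scope residuated_scope.
Context d (A : residuatedLatticeType d).

(** A finite orthogonal family of complemented elements with join 1 splits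
    [A] as the product of the intervals below them. *)
Lemma orthogonal_product n (e : 'I_n -> A) (he : forall i, complemented (e i)) :
  (forall i j, i != j -> e i ⊙ e j = \bot) -> \join_(i < n) e i = \top ->
  rl_isomorphic A (rl_prod (fun i => lower_interval (he i))).
Proof.
move=> orth cover.
pose f a : rl_prod (fun i => lower_interval (he i)) :=
  [ffun i => li_proj (he i) a].
have hom i := li_proj_hom (he i).
exists f; split.
- pose g (h : rl_prod (fun i => lower_interval (he i))) : A :=
    \join_(i < n) li_val (h i).
  (* the inverse map takes the join of the coordinates *)
  exists g => [a|h]; rewrite /g.
    under eq_bigr => i _ do rewrite ffunE li_val_proj odotC.
    by rewrite -joins_odotl cover odot1x.
  apply/ffunP => i; apply: li_val_inj.
  rewrite ffunE li_val_proj joins_odotl (bigD1 i)//= big1 ?joinx0.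
    exact/complemented_odot_id/li_valP.
  move=> j ji; apply/eqP; rewrite -lex0 -(orth _ _ ji).
  exact/le_odot2r/li_valP.
- by split=> a b; apply/ffunP => i; have [[hU hI] _ _] := hom i;
    rewrite !ffunE (hU, hI).
- by split=> a b; apply/ffunP => i; have [_ [hM hR] _] := hom i;
    rewrite !ffunE (hM, hR).
- by split; apply/ffunP => i; rewrite !ffunE; have [_ _ []] := hom i.
Qed.

Hypothesis prelinear : forall a b : A, (a ⇒ b) `|` (b ⇒ a) = \top.

(** Under prelinearity, finitely many maximal filters are separated from each
    other by complemented elements. *)
Lemma maximal_filter_separation n (M : 'I_n -> set A) :
  injective M -> (forall N, maximal_filter N <-> exists i, N = M i) ->
  forall i, exists e c, [/\ e `|` c = \top, e ⊙ c = \bot,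
    M i e & forall j, j != i -> M j c].
Proof.
move=> injM MP i.
have maxM j : maximal_filter (M j) by apply/MP; exists j.
have pM j : proper_filter (M j) by case: (maxM j).
have fM j : is_filter (M j) by case: (pM j).
have M0 j : ~ M j \bot by have /proper_filterP[] := pM j.
have Modot j : forall a b, M j a -> M j b -> M j (a ⊙ b) by case: (fM j).
have Mup j : forall a b, M j a -> a <= b -> M j b by case: (fM j).
(* an element of M i outside all the other maximal filters *)
have [a [Mia nMa]] : exists a, M i a /\ forall j, j != i -> ~ M j a.
  have wit j : exists a, j != i -> M i a /\ ~ M j a.
    have [-> | ji] := eqVneq j i; first by exists \top.
    apply: contrapT => noa; case/eqP: ji; apply: injM.
    have [_ maxMi] := maxM i; apply: maxMi => // a Ma.
    by apply: contrapT => nMja; apply: noa; exists a.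
  have /choice[a aP] := wit.
  exists (\big[@odot d A / \top]_(j < n | j != i) a j); split.
    by apply: filter_bigodot => // j /aP[].
  move=> j ji Mj; have [_] := aP j ji; apply; apply: Mup Mj _.
  exact: (le_bigodot a (P := fun j => j != i)).
(* a power b of a whose negation lies in all the other maximal filters *)
have [b [Mib Mnb]] : exists b, M i b /\ forall j, j != i -> M j (¬ b).
  have wit j : exists k, j != i -> M j (¬ (rpow a k)).
    have [-> | ji] := eqVneq j i; first by exists 0.
    by have [k Mk] := maximal_filter_neg (maxM j) (nMa j ji); exists k.
  have /choice[k kP] := wit.
  exists (rpow a (\max_(j < n) k j)); split; first exact: filter_rpow.
  move=> j ji; apply: Mup (kP j ji) _.
  rewrite le_rimp (le_trans _ (rimp_mp (rpow a (k j)) \bot))// odotC.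
  by rewrite le_odot2r// le_rpow_exp// leq_bigmax.
pose y := ¬ b ⇒ b; pose x := b ⇒ ¬ b.
have yx : y `|` x = \top by apply: prelinear.
have Miy : M i y by apply: Mup Mib _; rewrite le_rimp le_odotl.
have Mjx j : j != i -> M j x.
  by move=> /Mnb Mj; apply: Mup Mj _; rewrite le_rimp le_odotl.
have [k k0] : nilpotent (y ⊙ x).
  apply: nilpotent_of_maximal => N /MP[j ->] Mj.
  have [Mjy Mjx'] : M j y /\ M j x.
    by split; apply: Mup Mj _; rewrite ?le_odotl ?le_odotr.
  apply: (M0 j); have [ji|ji] := eqVneq j i.
    (* x and b give ¬ b by modus ponens, hence bottom *)
    move: Mjx'; rewrite ji => Mix.
    apply: Mup (Modot _ _ _ Mib (Modot _ _ _ Mib Mix)) _.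
    by rewrite (le_trans (le_odot2 (lexx b) (rimp_mp _ _)))// rimp_mp.
  have Mjn := Mnb j ji.
  apply: Mup (Modot _ _ _ (Modot _ _ _ Mjn Mjy) Mjn) _.
  by rewrite (le_trans (le_odot2r _ (rimp_mp _ _)))// rimp_mp.
exists (rpow y k), (rpow x k); split.
- exact: join_rpow_top.
- by rewrite -rpowMn.
- exact: filter_rpow.
- by move=> j ji; apply: filter_rpow => //; apply: Mjx.
Qed.

(** Prelinearity suffices for the decomposition: divisibility is not needed. *)
Lemma semilocal_decomposition : semilocal A ->
  exists (n : nat) (B : 'I_n -> residuatedLatticeType d),
    [/\ forall i, local (B i),
        forall i, exists2 f : A -> B i,
          rl_hom f & forall b, exists a, f a = b &
        rl_isomorphic A (rl_prod B)].
Proof.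
move=> /finite_seqP[s sE].
pose M (i : 'I_(size (undup s))) := tnth (in_tuple (undup s)) i.
have injM : injective M by apply/tuple_uniqP/undup_uniq.
have MP N : maximal_filter N <-> exists i, N = M i.
  have -> : maximal_filter N = (N \in s) :> Prop.
    by rewrite -[LHS]/([set F | maximal_filter F]%classic N) sE.
  rewrite -mem_undup; split=> [/(@tnthP _ _ (in_tuple (undup s)))//|[i ->]].
  exact: (mem_tnth i (in_tuple (undup s))).
have maxM i : maximal_filter (M i) by apply/MP; exists i.
have sep := maximal_filter_separation injM MP.
have /choice[e /choice[c ecP]] := sep.
have he i : complemented (e i) by exists (c i); case: (ecP i).
have proper_bot i (a b : A) : a ⊙ b = \bot -> M i a -> M i b -> False.
  have [/proper_filterP[[_ MM _] M0] _] := maxM i.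
  by move=> ab Ma Mb; apply: M0; rewrite -ab; apply: MM.
have Mie i : M i (e i) by case: (ecP i).
have Mje i j : M j (e i) -> j = i.
  have [_ e0 _ Mc] := ecP i.
  by move=> Mje; apply: contrapT => /eqP /Mc; apply: (proper_bot j _ _ e0).
have idem_e i : e i ⊙ e i = e i.
  by have [ec e0 _ _] := ecP i; apply: complement_idem ec e0.
have idem_c i : c i ⊙ c i = c i.
  have [ec e0 _ _] := ecP i.
  by apply: (@complement_idem _ _ _ (e i)); rewrite 1?joinC// odotC.
exists _, (fun i => lower_interval (he i)); split=> [i|i|].
- apply: (li_local (he i) (maxM i)) => // N /MP[j ->] Mj.
  by rewrite (Mje i j).
- exists (li_proj (he i)); first exact: li_proj_hom.
  by move=> b; exists (li_val b); exact: li_valK.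
- apply: orthogonal_product => [i j ij|].
    apply: nilpotent_idem; last by rewrite odotACA !idem_e.
    apply: nilpotent_of_maximal => _ /MP[k ->] Mk.
    have [/proper_filterP[[_ _ Mup] _] _] := maxM k.
    case/eqP: ij; rewrite -(Mje i k); last by apply: Mup Mk (le_odotl _ _).
    by apply: Mje; apply: Mup Mk (le_odotr _ _).
  (* the product of the complements lies in no maximal filter, hence is 0 *)
  have c0 : \big[@odot d A / \top]_i c i = \bot.
    apply: nilpotent_idem; last first.
      by apply: (big_ind (fun a : A => a ⊙ a = a)) => // [|a b aa bb];
        rewrite ?odot1x// odotACA aa bb.
    apply: nilpotent_of_maximal => _ /MP[k ->] Mk.
    have [/proper_filterP[[_ _ Mup] _] _] := maxM k.
    have [_ e0 Mke _] := ecP k.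
    apply: (proper_bot k _ _ e0 Mke); apply: Mup Mk _.
    exact: (le_bigodot c (P := xpredT)).
  rewrite -[LHS]joinx0 -[X in _ `|` X]c0; apply: join_bigodot_top => i.
  have [ec _ _ _] := ecP i.
  by apply/eqP; rewrite -le1x -ec leU2// joins_sup.
Qed.

End Decomposition.

(** * Semilocal algebras as products of local ones *)

Section ProductProjections.
Local Open Scope order_scope.
Local Open Scope residuated_scope.
Context (d d' : Order.disp_t) (n : nat) (A : residuatedLatticeType d).
Context (B : 'I_n -> residuatedLatticeType d').

Lemma rl_isomorphic_projections : rl_isomorphic A (rl_prod B) ->
  exists f : forall i, A -> B i, (forall i, rl_hom (f i)) /\
    (forall a b, (forall i, f i a = f i b) -> a = b).
Proof.
move=> [f [/bij_inj injf [fU fI] [fM fR] [f0 f1]]].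
exists (fun i a => f a i); split=> [i|a b fab]; last exact/injf/ffunP.
by split; split; do ?[move=> a b]; rewrite ?(fU, fI, fM, fR, f0, f1) ffunE.
Qed.

End ProductProjections.

Theorem corollary6p22 (d : Order.disp_t) (A : residuatedLatticeType d) :
  ((semilocal A /\ MV_algebra A) <->
   (exists (n : nat) (B : 'I_n -> residuatedLatticeType d),
      (forall i : 'I_n, local (B i) /\ MV_algebra (B i)) /\
      rl_isomorphic A (rl_prod B)))
  /\
  ((semilocal A /\ BL_algebra A) <->
   (exists (n : nat) (B : 'I_n -> residuatedLatticeType d),
      (forall i : 'I_n, local (B i) /\ BL_algebra (B i)) /\
      rl_isomorphic A (rl_prod B))).
Proof.
split; split.
- move=> [slA MVA]; have [[_ prelin] _] := MVA.
  have [n [B [locB surjB iso]]] := semilocal_decomposition prelin slA.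
  exists n, B; split=> // i; split=> //.
  by have [f homf surj] := surjB i; apply: MV_algebra_image homf surj MVA.
- move=> [n [B [LB /rl_isomorphic_projections[f [homf injf]]]]]; split.
    by apply: semilocal_subdirect homf injf _ => i; case: (LB i).
  by apply: MV_algebra_subdirect homf injf _ => i; case: (LB i).
- move=> [slA BLA]; have [_ prelin] := BLA.
  have [n [B [locB surjB iso]]] := semilocal_decomposition prelin slA.
  exists n, B; split=> // i; split=> //.
  by have [f homf surj] := surjB i; apply: BL_algebra_image homf surj BLA.
- move=> [n [B [LB /rl_isomorphic_projections[f [homf injf]]]]]; split.
    by apply: semilocal_subdirect homf injf _ => i; case: (LB i).
  by apply: BL_algebra_subdirect homf injf _ => i; case: (LB i).
Qed.
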